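(* For all positive integers $m,q$, each of the polynomials (a) $(1+z^m)(1+z^q)+1$, (b) $(z^m-1)(z^q-1)+1$ is an integer expanding polynomial with leading coefficient $1$ and free term $\pm2$.
   Context: A polynomial is called expanding if all its complex roots have modulus strictly greater than $1$. An integer polynomial is a polynomial with integer coefficients. *)

(* Defs.v *)
From mathcomp Require Import all_boot all_order all_algebra.
From mathcomp Require Import reals complex.

Set Implicit Arguments.
Unset Strict Implicit.
Unset Printing Implicit Defensive.

Import Order.TTheory GRing.Theory Num.Theory.

Local Open Scope ring_scope.
Local Open Scope complex_scope.

Definition integer_poly (R : realType) (p : {poly R[i]}) : Prop :=
  forall i : nat, exists k : int, p`_i = k%:~R.

(* The norm `|z| is R[i]-valued, with zero imaginary part, so that 1 < `|z| in
   the partial order of R[i] is the usual comparison of the modulus with 1. *)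
Definition expanding (R : realType) (p : {poly R[i]}) : Prop :=
  forall z : R[i], root p z -> 1 < `|z|.

(* Main.v *)
Require Import Defs.
From mathcomp Require Import all_boot all_order all_algebra.
From mathcomp Require Import reals complex.

Import Order.TTheory GRing.Theory Num.Theory.

Local Open Scope ring_scope.
Local Open Scope complex_scope.

(** If [|z| <= 1], the points [w = 1 + z^m] and [1 + z^q] (resp. [1 - z^m] and
    [1 - z^q]) lie in the closed unit disk centred at [1], i.e.
    [|w|^2 <= 2 Re w].  Two such points cannot have product [-1], because
    [w |-> -1/w] maps the right half-plane to the left one. *)

Lemma normsq_le_addC_conj (C : numClosedFieldType) (a : C) :
  `|a| <= 1 -> `|1 + a| ^+ 2 <= (1 + a) + (1 + a)^*.
Proof.
move=> a_le1; have : `|a| ^+ 2 <= 1 by rewrite expr_le1.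
rewrite !normCK rmorphD rmorph1 mulrDl mul1r => aa_le1.
by rewrite [leRHS]addrC lerD2l mulrDr mulr1 addrC lerD2r.
Qed.

Lemma mul_disk1_neqN1 (C : numClosedFieldType) (a b : C) :
  `|a| <= 1 -> `|b| <= 1 -> (1 + a) * (1 + b) != -1.
Proof.
move=> /normsq_le_addC_conj; set u := 1 + a => u_disk.
move=> /normsq_le_addC_conj; set v := 1 + b => v_disk.
apply/eqP => uv.
have uv_conj : u^* * v^* = -1 by rewrite -rmorphM /= uv rmorphN1.
have : `|u| ^+ 2 * `|v| ^+ 2 <= `|u| ^+ 2 * (v + v^*).
  by rewrite ler_wpM2l ?exprn_ge0.
have -> : `|u| ^+ 2 * (v + v^*) = - (u + u^*).
  rewrite normCK mulrDr -[u * u^* * v^*]mulrA uv_conj mulrN1.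
  by rewrite [u * _]mulrC -mulrA uv mulrN1 -opprD addrC.
rewrite -exprMn -normrM uv normrN1 expr1n lerNr => u_leN1.
(* The chain [0 <= |u|^2 <= u + u^* <= -1] is absurd. *)
have := le_trans (exprn_ge0 2 (normr_ge0 u)) (le_trans u_disk u_leN1).
by rewrite oppr_ge0 ler10.
Qed.

(** Treats both families at once: [s = 1] gives (a) and [s = -1] gives (b). As [|s| = 1], each
    [s * z^k] stays in the closed unit disk when [|z| <= 1]. *)
Lemma expanding_mul_disk1 (R : realType) (s : R[i]) (m q : nat) :
  `|s| = 1 -> expanding ((1 + s *: 'X^m) * (1 + s *: 'X^q) + 1).
Proof.
move=> s1 z; rewrite /root !hornerE => /eqP z_root.
(* The order on [R[i]] is partial; the negation of [1 < |z|] is [|z| <= 1] because both sides are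
   real. *)
rewrite real_ltNge ?real1 ?normr_real //; apply/negP => z_le1.
have disk k : `|s * z ^+ k| <= 1 by rewrite normrM s1 mul1r normrX exprn_ile1.
have /eqP[] := mul_disk1_neqN1 _ _ _ (disk m) (disk q).
by apply/eqP; rewrite -addr_eq0; apply/eqP.
Qed.

Lemma integer_poly_map_intr (R : realType) (p : {poly int}) :
  integer_poly (map_poly intr p : {poly R[i]}).
Proof. by move=> i; exists p`_i; rewrite coef_map. Qed.

(** The product is monic of degree [m + q > 0], so adding [1] leaves its leading term alone. It is
    used with [c = -1] for (a) and [c = 1] for (b). *)
Lemma lead_coef_mul_XnsubC_add1 (A : idomainType) (c : A) (m q : nat) :
  (0 < m)%N -> (0 < q)%N ->
  lead_coef (('X^m - c%:P) * ('X^q - c%:P) + 1) = 1.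
Proof.
move=> m_gt0 q_gt0.
have Xc_monic k : (0 < k)%N -> 'X^k - c%:P \is monic by exact: monicXnsubC.
rewrite lead_coefDl; last first.
  rewrite size_poly1 size_monicM ?Xc_monic ?monic_neq0 ?Xc_monic //.
  by rewrite !size_XnsubC // addSn addnS /= ltnS addn_gt0 m_gt0.
by apply/monicP; rewrite monicMr Xc_monic.
Qed.

Theorem mainTheorem13 (R : realType) (m q : nat) (m_gt0 : (0 < m)%N)
    (q_gt0 : (0 < q)%N) :
  let pa : {poly R[i]} := (1 + 'X^m) * (1 + 'X^q) + 1 in
  let pb : {poly R[i]} := ('X^m - 1) * ('X^q - 1) + 1 in
  [/\ integer_poly pa, expanding pa, lead_coef pa = 1
    & pa`_0 = 2%:R \/ pa`_0 = - 2%:R] /\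
  [/\ integer_poly pb, expanding pb, lead_coef pb = 1
    & pb`_0 = 2%:R \/ pb`_0 = - 2%:R].
Proof.
move=> pa pb; split; split.
- have -> : pa = map_poly intr ((1 + 'X^m) * (1 + 'X^q) + 1 : {poly int}).
    by rewrite rmorphD rmorphM !rmorphD /= !map_polyXn !rmorph1.
  exact: integer_poly_map_intr.
- by have := expanding_mul_disk1 R 1 m q (normr1 _); rewrite !scale1r.
- rewrite /pa ![1 + 'X^_]addrC -[X in 'X^m + X]opprK -[X in 'X^q + X]opprK.
  by rewrite -polyCN lead_coef_mul_XnsubC_add1.
(* The free term is the value at [0], where [0^m = 0^q = 0] by positivity of the exponents. *)
- by left; rewrite -horner_coef0 !hornerE !expr0n !gtn_eqF // !addr0 mul1r.
- have -> : pb = map_poly intr (('X^m - 1) * ('X^q - 1) + 1 : {poly int}).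
    by rewrite rmorphD rmorphM !rmorphB /= !map_polyXn !rmorph1.
  exact: integer_poly_map_intr.
- have := expanding_mul_disk1 R (-1) m q (normrN1 _).
  by rewrite !scaleN1r -mulrNN !opprB.
- by rewrite lead_coef_mul_XnsubC_add1.
- by left; rewrite -horner_coef0 !hornerE !expr0n !gtn_eqF // !sub0r mulrNN mul1r.
Qed.
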